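(* Let $(M,\psi,\xi,\eta,g)$ be a Kenmotsu manifold with Levi-Civita connection $D$, let $\alpha,\beta$ be smooth functions on $M$, and let $\overline{D}$ be the generalized symmetric metric connection of type $(\alpha,\beta)$ on $M$. Then $\overline{D}$ is given by $$\overline{D}_{U}V=D_{U}V+\alpha\{\eta(V)U-g(U,V)\xi\}-\beta\,\eta(U)\psi V$$ for all vector fields $U,V$ on $M$.
   Context: An almost contact metric manifold $(M,\psi,\xi,\eta,g)$ is a smooth manifold of dimension $n=2m+1$ with a $(1,1)$ tensor field $\psi$, a vector field $\xi$, a $1$-form $\eta$ and a Riemannian metric $g$ satisfying $\psi\xi=0$, $\eta(\psi U)=0$, $\eta(\xi)=1$, $\psi^{2}U=-U+\eta(U)\xi$, $g(\psi U,\psi V)=g(U,V)-\eta(U)\eta(V)$, $g(U,\xi)=\eta(U)$ for all vector fields $U,V$; then $g(U,\psi V)=\Phi(U,V)$ is skew-symmetric. It is a Kenmotsu manifold if, for the Levi-Civita connection $D$ of $g$, $(D_{U}\psi)V=g(\psi U,V)\xi-\eta(V)\psi U$ and $D_{U}\xi=U-\eta(U)\xi$. A generalized symmetric metric connection of type $(\alpha,\beta)$ on $M$ (with $\alpha,\beta$ smooth functions on $M$) is a linear connection $\overline{D}$ with $\overline{D}g=0$ whose torsion tensor is $T(U,V)=\alpha\{\eta(V)U-\eta(U)V\}+\beta\{\eta(V)\psi U-\eta(U)\psi V\}$. *)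

(* Defs.v *)
From HB Require Import structures.
From mathcomp Require Import all_boot all_order all_algebra.
From mathcomp Require Import all_classical all_reals all_analysis.
From mathcomp Require Import ring.

Set Implicit Arguments.
Unset Strict Implicit.
Unset Printing Implicit Defensive.

Import Order.TTheory GRing.Theory Num.Theory.
Import numFieldNormedType.Exports.

Local Open Scope classical_set_scope.
Local Open Scope ring_scope.

Section SmoothOn.
Context {R : realType} {n : nat}.
Implicit Types (A : set 'rV[R]_n) (f g : 'rV[R]_n -> R^o).

(* [A] is meant to be open: all partial derivatives of order at most [k]
   exist and are continuous at every point of [A]. *)
Fixpoint Ck_on (k : nat) A f : Prop :=
  (forall x, A x -> {for x, continuous f}) /\
  if k is k'.+1 then
    forall i : 'I_n, (forall x, A x -> derivable f x (delta_mx 0 i)) /\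
                     Ck_on k' A ('D_(delta_mx 0 i) f)
  else True.

Definition smooth_on A f : Prop := forall k, Ck_on k A f.

Lemma Ck_on_cont k A f : Ck_on k A f -> forall x, A x -> {for x, continuous f}.
Proof. by case: k => [|k] []. Qed.

Lemma Ck_on_weaken k A f : Ck_on k.+1 A f -> Ck_on k A f.
Proof.
elim: k f => [|k IH] f [fc fd]; split=> // i; have [fi fk] := fd i.
by split=> //; exact: IH.
Qed.

Lemma Ck_on_eq k A f g : open A -> {in A, f =1 g} -> Ck_on k A f -> Ck_on k A g.
Proof.
move=> oA; elim: k f g => [|k IH] f g fg [fc fd].
all: have nfg x (Ax : A x) : \near x, f x = g x
  by apply: filterS (open_nbhs_nbhs (conj oA Ax)) => y Ay; apply/fg/mem_set.
all: split=> [x Ax|]; first (rewrite /prop_for /continuous_at;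
  rewrite -(fg x (mem_set Ax)); exact: cvg_trans (near_eq_cvg (nfg x Ax)) (fc x Ax)).
  by [].
move=> i; have [fi fk] := fd i; split=> [x Ax|].
  exact: near_eq_derivable (nfg x Ax) (fi x Ax).
by apply: IH fk => x /set_mem Ax; apply: near_eq_derive; exact: nfg.
Qed.

Lemma Ck_on_cst k A (c : R) : Ck_on k A (cst c).
Proof.
elim: k c => [|k IH] c.
all: split=> [x _|]; first exact: cst_continuous.
  by [].
move=> i; split=> [x _|]; first exact: derivable_cst.
suff -> : 'D_(delta_mx 0 i) (cst c : 'rV[R]_n -> R^o) = cst 0 by exact: IH.
by apply/funext => x; rewrite derive_cst.
Qed.

Lemma Ck_onD k A f g : open A ->
  Ck_on k A f -> Ck_on k A g -> Ck_on k A (f + g).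
Proof.
move=> oA; elim: k f g => [|k IH] f g [fc fd] [gc gd].
all: split=> [x Ax|]; first exact: (continuousD (fc x Ax) (gc x Ax)).
  by [].
move=> i; have [fi fk] := fd i; have [gi gk] := gd i; split=> [x Ax|].
  by apply: derivableD; [exact: fi|exact: gi].
apply: Ck_on_eq oA _ (IH _ _ fk gk) => x /set_mem Ax.
by rewrite deriveD; [|exact: fi|exact: gi].
Qed.

Lemma Ck_onM k A f g : open A ->
  Ck_on k A f -> Ck_on k A g -> Ck_on k A (f * g).
Proof.
move=> oA; elim: k f g => [|k IH] f g fs gs.
all: have [fc fd] := fs; have [gc gd] := gs.
all: split=> [x Ax|]; first exact: (continuousM (fc x Ax) (gc x Ax)).
  by [].
move=> i; have [fi fk] := fd i; have [gi gk] := gd i; split=> [x Ax|].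
  by apply: derivableM; [exact: fi|exact: gi].
have := Ck_onD oA (IH _ _ (Ck_on_weaken fs) gk) (IH _ _ (Ck_on_weaken gs) fk).
apply: Ck_on_eq oA _ => x /set_mem Ax.
by rewrite deriveM; [|exact: fi|exact: gi].
Qed.

End SmoothOn.

(* [chart_inv] is total; it is only constrained on the image of the domain. *)
Record chart (R : realType) (n : nat) (M : topologicalType) := Chart {
  chart_dom : set M;
  chart_map :> M -> 'rV[R]_n;
  chart_inv : 'rV[R]_n -> M;
  chart_dom_open : open chart_dom;
  chart_img_open : open (chart_map @` chart_dom);
  chart_mapK : {in chart_dom, cancel chart_map chart_inv};
  chart_map_continuous : {within chart_dom, continuous chart_map};
  chart_inv_continuous : {within chart_map @` chart_dom, continuous chart_inv}
}.

Definition compatible_charts (R : realType) (n : nat) (M : topologicalType)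
    (c d : chart R n M) : Prop :=
  forall i : 'I_n, smooth_on (c @` (chart_dom c `&` chart_dom d))
                             (fun x => d (chart_inv c x) 0 i).

(* The atlas need not be maximal. *)
Record manifold (R : realType) (n : nat) := Manifold {
  manifold_space :> topologicalType;
  manifold_hausdorff : hausdorff_space manifold_space;
  manifold_second_countable : @second_countable manifold_space;
  atlas : set (chart R n manifold_space);
  atlas_cover : forall p, exists2 c, atlas c & chart_dom c p;
  atlas_compatible : forall c d, atlas c -> atlas d -> compatible_charts c d
}.

Section SmoothFunctions.
Context {R : realType} {n : nat} (M : manifold R n).
Implicit Types f g : M -> R^o.

Definition smooth_fun f : Prop := forall c, atlas (m := M) c ->
  smooth_on (c @` chart_dom c) (f \o chart_inv c).

Definition smooth_fun_pred : {pred M -> R^o} := fun f => `[< smooth_fun f >].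

Lemma smooth_cst (a : R) : smooth_fun (cst a).
Proof. by move=> c cM k; exact: Ck_on_cst. Qed.

Lemma smoothD f g : smooth_fun f -> smooth_fun g -> smooth_fun (f + g).
Proof.
move=> fs gs c cM k; apply: (Ck_onD _ (fs c cM k) (gs c cM k)).
exact: chart_img_open.
Qed.

Lemma smoothM f g : smooth_fun f -> smooth_fun g -> smooth_fun (f * g).
Proof.
move=> fs gs c cM k; apply: (Ck_onM _ (fs c cM k) (gs c cM k)).
exact: chart_img_open.
Qed.

Lemma smoothZ (a : R) f : smooth_fun f -> smooth_fun (a *: f).
Proof. exact/smoothM/smooth_cst. Qed.

Lemma smooth_fun_subring : subring_closed smooth_fun_pred.
Proof.
split=> [|f g /asboolP fs /asboolP gs|f g /asboolP fs /asboolP gs];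
  apply/asboolP; [exact: smooth_cst| |exact: smoothM].
by rewrite -scaleN1r; exact/smoothD/smoothZ.
Qed.

Lemma smooth_fun_scaler : scaler_closed smooth_fun_pred.
Proof. by move=> a f /asboolP fs; apply/asboolP; exact: smoothZ. Qed.

HB.instance Definition _ :=
  GRing.isSubringClosed.Build (M -> R^o) smooth_fun_pred smooth_fun_subring.
HB.instance Definition _ :=
  GRing.isScaleClosed.Build R (M -> R^o) smooth_fun_pred smooth_fun_scaler.

Record Cinfty := MkCinfty {
  Cinfty_val :> M -> R^o; Cinfty_valP : Cinfty_val \in smooth_fun_pred }.

HB.instance Definition _ := [isSub for Cinfty_val].
HB.instance Definition _ := [Choice of Cinfty by <:].
HB.instance Definition _ :=
  GRing.SubChoice_isSubComPzRing.Build _ _ Cinfty smooth_fun_subring.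
HB.instance Definition _ := [SubZmodule_isSubLmodule of Cinfty by <:].

Definition to_Cinfty f (fs : smooth_fun f) : Cinfty := MkCinfty (asboolT fs).

Lemma Cinfty_smooth (f : Cinfty) : smooth_fun f.
Proof. exact: asboolW (Cinfty_valP f). Qed.

Lemma Cinfty_ext (f g : Cinfty) : (forall p, f p = g p) -> f = g.
Proof. by move=> fg; apply/val_inj/funext. Qed.

End SmoothFunctions.

Section TangentSpace.
Context {R : realType} {n : nat} {M : manifold R n} (p : M).
Implicit Types v : Cinfty M -> R^o.

(* Tangent vectors at [p] are the derivations at [p] of the algebra of globally
   defined smooth functions; tensor fields are families of multilinear maps on
   tangent spaces, smooth in the sense that they send smooth vector fields to
   smooth functions or vector fields. *)
Definition derivation_at v : Prop :=
  linear v /\ forall f g : Cinfty M, v (f * g) = f p * v g + g p * v f.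

Definition derivation_at_pred : {pred Cinfty M -> R^o} :=
  fun v => `[< derivation_at v >].

Lemma derivation_at_submod : subsemimod_closed derivation_at_pred.
Proof.
have zE f : (0 : Cinfty M -> R^o) f = 0 by [].
have aE v w f : (v + w) f = v f + w f by [].
have sE (a : R) v f : (a *: v) f = a * v f by [].
split; [split|].
- apply/asboolP; split=> [a f g|f g]; rewrite !zE.
    by rewrite scaler0 addr0.
  by rewrite !mulr0 addr0.
- move=> v w /asboolP [vl vM] /asboolP [wl wM]; apply/asboolP.
  split=> [a f g|f g]; rewrite !aE.
    by rewrite vl wl scalerDr addrACA.
  by rewrite vM wM !mulrDr addrACA.
- move=> a v /asboolP [vl vM]; apply/asboolP.
  split=> [b f g|f g]; rewrite !sE.
    by rewrite vl mulrDr mulrCA.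
  by rewrite vM mulrDr (mulrCA a) (mulrCA a).
Qed.

HB.instance Definition _ := GRing.isSubmodClosed.Build R (Cinfty M -> R^o)
  derivation_at_pred derivation_at_submod.

Record tangent := MkTangent {
  tangent_val :> Cinfty M -> R^o; tangent_valP : tangent_val \in derivation_at_pred }.

HB.instance Definition _ := [isSub for tangent_val].
HB.instance Definition _ := [Choice of tangent by <:].
HB.instance Definition _ := [SubChoice_isSubLmodule of tangent by <:].

Definition to_tangent v (dv : derivation_at v) : tangent :=
  MkTangent (asboolT dv).

Lemma tangent_derivation (v : tangent) : derivation_at v.
Proof. exact: asboolW (tangent_valP v). Qed.

Lemma tangent0E f : (0 : tangent) f = 0.
Proof. by have -> : \val (0 : tangent) = 0 by exact: raddf0. Qed.

Lemma tangentDE (v w : tangent) f : (v + w) f = v f + w f.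
Proof. by have -> : \val (v + w) = \val v + \val w by exact: raddfD. Qed.

Lemma tangentNE (v : tangent) f : (- v) f = - v f.
Proof. by have -> : \val (- v) = - \val v by exact: raddfN. Qed.

Lemma tangentZE (a : R) (v : tangent) f : (a *: v) f = a * v f.
Proof. by have -> : \val (a *: v) = a *: \val v by exact: linearZ. Qed.

End TangentSpace.

Record vfield (R : realType) (n : nat) (M : manifold R n) := Vfield {
  vfield_at : forall p : M, tangent p;
  vfield_smooth : forall f : Cinfty M, smooth_fun (fun p => vfield_at p f)
}.

Section VectorFields.
Context {R : realType} {n : nat} {M : manifold R n}.
Implicit Types (X Y : vfield M) (f g : Cinfty M).

Lemma vfield_ext X Y : (forall p, vfield_at X p = vfield_at Y p) -> X = Y.
Proof.
case: X Y => [X Xs] [Y Ys] /= XY.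
have {}XY : X = Y by apply: functional_extensionality_dep.
by rewrite XY in Xs *; congr Vfield; exact: Prop_irrelevance.
Qed.

HB.instance Definition _ := gen_eqMixin (vfield M).
HB.instance Definition _ := gen_choiceMixin (vfield M).

Definition dirder X f : Cinfty M := to_Cinfty (vfield_smooth X f).

Lemma vfield0_smooth f : smooth_fun (fun p : M => (0 : tangent p) f).
Proof.
rewrite (_ : (fun p => _) = cst 0); first exact: smooth_cst.
by apply/funext => p; exact: tangent0E.
Qed.

Lemma vfieldD_smooth X Y f :
  smooth_fun (fun p => (vfield_at X p + vfield_at Y p) f).
Proof.
rewrite (_ : (fun p => _) = dirder X f + dirder Y f :> (M -> R^o)).
  by apply: smoothD; exact: Cinfty_smooth.
by apply/funext => p; exact: tangentDE.
Qed.

Lemma vfieldZ_smooth g X f : smooth_fun (fun p => (g p *: vfield_at X p) f).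
Proof.
rewrite (_ : (fun p => _) = (g : M -> R^o) * dirder X f :> (M -> R^o)).
  by apply: smoothM; exact: Cinfty_smooth.
by apply/funext => p; exact: tangentZE.
Qed.

Lemma vfieldN_smooth X f : smooth_fun (fun p => (- vfield_at X p) f).
Proof.
rewrite (_ : (fun p => _) = -1 *: (dirder X f : M -> R^o)).
  by apply: smoothZ; exact: Cinfty_smooth.
by apply/funext => p; rewrite tangentNE -[LHS]mulN1r.
Qed.

Definition vfield0 := Vfield vfield0_smooth.
Definition vfieldD X Y := Vfield (vfieldD_smooth X Y).
Definition vfieldN X := Vfield (vfieldN_smooth X).
Definition vfieldZ f X := Vfield (vfieldZ_smooth f X).

Lemma vfieldDA : associative vfieldD.
Proof. by move=> X Y Z; apply: vfield_ext => p; exact: addrA. Qed.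
Lemma vfieldDC : commutative vfieldD.
Proof. by move=> X Y; apply: vfield_ext => p; exact: addrC. Qed.
Lemma vfield0D : left_id vfield0 vfieldD.
Proof. by move=> X; apply: vfield_ext => p; exact: add0r. Qed.
Lemma vfieldND : left_inverse vfield0 vfieldN vfieldD.
Proof. by move=> X; apply: vfield_ext => p; exact: addNr. Qed.

HB.instance Definition _ := GRing.isZmodule.Build (vfield M)
  vfieldDA vfieldDC vfield0D vfieldND.

Lemma vfieldZA f g X : vfieldZ f (vfieldZ g X) = vfieldZ (f * g) X.
Proof. by apply: vfield_ext => p; exact: scalerA. Qed.
Lemma vfield1Z : left_id 1 vfieldZ.
Proof. by move=> X; apply: vfield_ext => p; exact: scale1r. Qed.
Lemma vfieldZDr : right_distributive vfieldZ +%R.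
Proof. by move=> f X Y; apply: vfield_ext => p; exact: scalerDr. Qed.
Lemma vfieldZDl X : {morph vfieldZ^~ X : f g / f + g}.
Proof. by move=> f g; apply: vfield_ext => p; exact: scalerDl. Qed.

HB.instance Definition _ := GRing.Zmodule_isLmodule.Build (Cinfty M) (vfield M)
  vfieldZA vfield1Z vfieldZDr vfieldZDl.

Definition bracket_at X Y (p : M) : Cinfty M -> R^o :=
  fun f => vfield_at X p (dirder Y f) - vfield_at Y p (dirder X f).

Lemma dirder_linear X (a : R) f g :
  dirder X (a *: f + g) = a *: dirder X f + dirder X g.
Proof.
apply/val_inj/funext => p; exact: (tangent_derivation (vfield_at X p)).1.
Qed.

Lemma dirderM X f g : dirder X (f * g) = f * dirder X g + g * dirder X f.
Proof.
apply/val_inj/funext => p; exact: (tangent_derivation (vfield_at X p)).2.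
Qed.

Lemma bracket_derivation X Y (p : M) : derivation_at p (bracket_at X Y p).
Proof.
have [Xl XM] := tangent_derivation (vfield_at X p).
have [Yl YM] := tangent_derivation (vfield_at Y p).
have XD f g : vfield_at X p (f + g) = vfield_at X p f + vfield_at X p g.
  by have := Xl 1 f g; rewrite !scale1r.
have YD f g : vfield_at Y p (f + g) = vfield_at Y p f + vfield_at Y p g.
  by have := Yl 1 f g; rewrite !scale1r.
split=> [a f g|f g]; rewrite /bracket_at.
  by rewrite !dirder_linear Xl Yl scalerBr opprD addrACA.
rewrite !dirderM XD YD !XM !YM /=.
ring.
Qed.

Lemma bracket_smooth X Y f :
  smooth_fun (fun p => to_tangent (bracket_derivation X Y p) f).
Proof.
exact: Cinfty_smooth (dirder X (dirder Y f) - dirder Y (dirder X f)).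
Qed.

Definition bracket X Y : vfield M := Vfield (bracket_smooth X Y).

End VectorFields.

Record one_form (R : realType) (n : nat) (M : manifold R n) := OneForm {
  one_form_at : forall p : M, {scalar tangent p};
  one_form_smooth : forall X : vfield M,
    smooth_fun (fun p => one_form_at p (vfield_at X p))
}.

Record tensor11 (R : realType) (n : nat) (M : manifold R n) := Tensor11 {
  tensor11_at : forall p : M, {linear tangent p -> tangent p};
  tensor11_smooth : forall (X : vfield M) (f : Cinfty M),
    smooth_fun (fun p => tensor11_at p (vfield_at X p) f)
}.

Record riemannian_metric (R : realType) (n : nat) (M : manifold R n) :=
  RiemannianMetric {
  riemannian_at : forall p : M,
    {bilinear tangent p -> tangent p -> R | *%R & *%R};
  riemannian_sym : forall p u v, riemannian_at p u v = riemannian_at p v u;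
  riemannian_pos : forall p u, u != 0 -> 0 < riemannian_at p u u;
  riemannian_smooth : forall X Y : vfield M,
    smooth_fun (fun p => riemannian_at p (vfield_at X p) (vfield_at Y p))
}.

Definition one_form_app (R : realType) (n : nat) (M : manifold R n)
    (w : one_form M) (X : vfield M) : Cinfty M :=
  to_Cinfty (one_form_smooth w X).
Coercion one_form_app : one_form >-> Funclass.

Definition tensor11_app (R : realType) (n : nat) (M : manifold R n)
    (A : tensor11 M) (X : vfield M) : vfield M :=
  Vfield (tensor11_smooth A X).
Coercion tensor11_app : tensor11 >-> Funclass.

Definition metric_app (R : realType) (n : nat) (M : manifold R n)
    (g : riemannian_metric M) (X Y : vfield M) : Cinfty M :=
  to_Cinfty (riemannian_smooth g X Y).
Coercion metric_app : riemannian_metric >-> Funclass.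

(* [R]-linearity in the second argument follows from [connection_leibniz]
   applied to constant functions. *)
Record connection (R : realType) (n : nat) (M : manifold R n) := Connection {
  connection_app :> vfield M -> vfield M -> vfield M;
  connection_linear : forall V (f : Cinfty M) U U',
    connection_app (f *: U + U') V = f *: connection_app U V + connection_app U' V;
  connection_add : forall U V V',
    connection_app U (V + V') = connection_app U V + connection_app U V';
  connection_leibniz : forall U (f : Cinfty M) V,
    connection_app U (f *: V) = dirder U f *: V + f *: connection_app U V
}.

Section Connections.
Context {R : realType} {n : nat} {M : manifold R n}.
Implicit Types (D : connection M) (g : riemannian_metric M).

Definition torsion D (U V : vfield M) : vfield M :=
  D U V - D V U - bracket U V.

Definition cov_metric D g (U V W : vfield M) : Cinfty M :=
  dirder U (g V W) - g (D U V) W - g V (D U W).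

Definition metric_connection D g : Prop :=
  forall U V W, cov_metric D g U V W = 0.

Definition levi_civita D g : Prop :=
  metric_connection D g /\ forall U V, torsion D U V = 0.

Definition cov_tensor11 D (A : tensor11 M) (U V : vfield M) : vfield M :=
  D U (A V) - A (D U V).

End Connections.

Section AlmostContact.
Context {R : realType} {m : nat} {M : manifold R m.*2.+1}.
Implicit Types (psi : tensor11 M) (xi : vfield M) (eta : one_form M)
  (g : riemannian_metric M) (D : connection M).

Record almost_contact_metric psi xi eta g : Prop := AlmostContactMetric {
  acm_psi_xi : psi xi = 0;
  acm_eta_psi : forall U, eta (psi U) = 0;
  acm_eta_xi : eta xi = 1;
  acm_psi2 : forall U, psi (psi U) = - U + eta U *: xi;
  acm_metric : forall U V, g (psi U) (psi V) = g U V - eta U * eta V;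
  acm_eta : forall U, g U xi = eta U
}.

Record kenmotsu psi xi eta g : Prop := Kenmotsu {
  kenmotsu_acm : almost_contact_metric psi xi eta g;
  kenmotsu_psi : forall D, levi_civita D g -> forall U V,
    cov_tensor11 D psi U V = g (psi U) V *: xi - eta V *: psi U;
  kenmotsu_xi : forall D, levi_civita D g -> forall U, D U xi = U - eta U *: xi
}.

Record generalized_symmetric_metric_connection psi eta g
    (alpha beta : Cinfty M) D : Prop := GeneralizedSymmetricMetric {
  gsm_metric : metric_connection D g;
  gsm_torsion : forall U V, torsion D U V =
    alpha *: (eta V *: U - eta U *: V) + beta *: (eta V *: psi U - eta U *: psi V)
}.

End AlmostContact.

(* Main.v *)
(* Metricity of both connections and the prescribed torsion of [Dbar] force the
   difference [S U V] between [Dbar U V] and the claimed value to be symmetric in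
   [U, V], while [g (S U V) W] is skew in [V, W]. As in the uniqueness part of
   the fundamental theorem of Riemannian geometry, a trilinear expression
   symmetric in its first two and skew in its last two arguments vanishes. *)
Require Import Defs.
From mathcomp Require Import all_boot all_order all_algebra.
From mathcomp Require Import all_classical all_reals all_analysis.
From mathcomp Require Import ring.

Set Implicit Arguments.
Unset Strict Implicit.
Unset Printing Implicit Defensive.

Import Order.TTheory GRing.Theory Num.Theory.
Local Open Scope ring_scope.

Section Metric.
Context {R : realType} {n : nat} {M : manifold R n} (g : riemannian_metric M).
Implicit Types X Y Z : vfield M.

Lemma metricC X Y : g X Y = g Y X.
Proof. by apply: Cinfty_ext => p; exact: riemannian_sym. Qed.

Lemma metricDl X Y Z : g (X + Y) Z = g X Z + g Y Z.
Proof. by apply: Cinfty_ext => p; exact: linearDl. Qed.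

Lemma metricNl X Z : g (- X) Z = - g X Z.
Proof. by apply: Cinfty_ext => p; exact: linearNl. Qed.

Lemma metricZl (f : Cinfty M) X Z : g (f *: X) Z = f * g X Z.
Proof. by apply: Cinfty_ext => p; exact: linearZl_LR. Qed.

Lemma metricDr X Y Z : g Z (X + Y) = g Z X + g Z Y.
Proof. by rewrite metricC metricDl !(metricC Z). Qed.

Lemma metricNr X Z : g Z (- X) = - g Z X.
Proof. by rewrite metricC metricNl (metricC Z). Qed.

Lemma metricZr (f : Cinfty M) X Z : g Z (f *: X) = f * g Z X.
Proof. by rewrite metricC metricZl (metricC Z). Qed.

Definition metricE :=
  (metricDl, metricDr, metricNl, metricNr, metricZl, metricZr).

Lemma metric_eq0 X : g X X = 0 -> X = 0.
Proof.
move=> gX0; apply: vfield_ext => p; apply/eqP; apply: contraT => Xp.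
have := riemannian_pos g Xp.
have -> : riemannian_at g p (vfield_at X p) (vfield_at X p) = g X X p by [].
by rewrite gX0 ltxx.
Qed.

Lemma sym_skew_eq0 (S : vfield M -> vfield M -> vfield M) :
    (forall X Y Z, g (S X Y) Z = g (S Y X) Z) ->
    (forall X Y Z, g (S X Y) Z = - g Y (S X Z)) ->
  forall X Y, S X Y = 0.
Proof.
(* Generalizing one copy of [S X Y] to [Z] lets it be permuted as an independent argument. *)
move=> Ssym Sskew X Y; apply: metric_eq0; move: {2}(S X Y) => Z.
have skew A B C : g (S A B) C = - g (S A C) B by rewrite Sskew metricC.
(* Six alternating transpositions of [X], [Y], [Z] compose to the identity, while the three skew
   ones contribute the sign [-1]. *)
have gN : g (S X Y) Z = - g (S X Y) Z.
  by rewrite {1}Ssym skew Ssym skew Ssym skew !opprK.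
apply: Cinfty_ext => p; have : g (S X Y) Z p = - g (S X Y) Z p by rewrite {1}gN.
by move=> /esym/eqP; rewrite eqNr => /eqP.
Qed.

Lemma metric_connectionE (D : connection M) X Y Z : metric_connection D g ->
  dirder X (g Y Z) = g (D X Y) Z + g Y (D X Z).
Proof.
move=> /(_ X Y Z)/eqP.
by rewrite /cov_metric -addrA -opprD subr_eq0 => /eqP.
Qed.

End Metric.

Section AlmostContactMetric.
Context {R : realType} {m : nat} {M : manifold R m.*2.+1}.
Context (psi : tensor11 M) (xi : vfield M) (eta : one_form M)
  (g : riemannian_metric M) (acm : almost_contact_metric psi xi eta g).

(** Compatibility of [g] with [psi] at [psi X] and [Y]: in [psi (psi X)] the [xi] component is
    orthogonal to [psi Y], which leaves [- X]. *)
Lemma acm_psi_skew X Y : g (psi X) Y = - g X (psi Y).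
Proof.
have := acm_metric acm (psi X) Y.
rewrite (acm_eta_psi acm) (acm_psi2 acm) mul0r subr0 => <-.
by rewrite !metricE (metricC g xi) (acm_eta acm) (acm_eta_psi acm) mulr0 addr0.
Qed.

End AlmostContactMetric.

Theorem corollary1 (R : realType) (m : nat) (M : manifold R m.*2.+1)
    (psi : tensor11 M) (xi : vfield M) (eta : one_form M)
    (g : riemannian_metric M) (hK : kenmotsu psi xi eta g)
    (D : connection M) (hD : levi_civita D g)
    (alpha beta : Cinfty M) (Dbar : connection M)
    (hDbar : generalized_symmetric_metric_connection psi eta g alpha beta Dbar)
    (U V : vfield M) :
  Dbar U V = D U V + alpha *: (eta V *: U - g U V *: xi)
             - (beta * eta U) *: psi V.
Proof.
have acm := kenmotsu_acm hK; have [Dg D0] := hD; have [Dbarg DbarT] := hDbar.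
apply/eqP; rewrite -subr_eq0; apply/eqP; move: U V.
pose S U V := Dbar U V - (D U V + alpha *: (eta V *: U - g U V *: xi)
                          - (beta * eta U) *: psi V).
apply: (@sym_skew_eq0 _ _ _ g S) => X Y Z; rewrite /S !metricE.
  (* Symmetry: the brackets from the two torsions cancel, the [xi] term is symmetric already, and
     antisymmetrizing the other [alpha] and [beta] terms gives exactly the prescribed torsion. *)
  have := congr1 (g^~ Z) (DbarT X Y); rewrite /torsion !metricE => /eqP.
  rewrite !subr_eq => /eqP ->.
  have := congr1 (g^~ Z) (D0 X Y); rewrite /torsion !metricE => /eqP.
  have -> : g 0 Z = 0 by rewrite -(scale0r 0) metricZl mul0r.
  rewrite !subr_eq add0r => /eqP ->.
  rewrite (metricC g Y X); ring.
(* Skewness: both connections split the same derivative of [g Y Z] along [X], so their difference is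
   skew; so are the [alpha] terms, and the [beta] term by skewness of [psi]. *)
have := metric_connectionE X Y Z Dbarg; rewrite (metric_connectionE _ _ _ Dg) => /eqP.
rewrite eq_sym -subr_eq => /eqP <-.
rewrite (metricC g xi Z) !(acm_eta acm) (acm_psi_skew acm) (metricC g X Y).
ring.
Qed.
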